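(* The sequence $\left(\frac{O_d}{O_{d-1}}\right)_{d\geq 2}$ is strongly Cesàro convergent to $1$; namely, for $N\to+\infty$, $$\frac{1}{N-1}\sum_{d=2}^N\left|\frac{O_d}{O_{d-1}}-1\right|\longrightarrow 0.$$ Equivalently, it is statistically convergent to $1$; namely, for every $\varepsilon>0$, for $N\to+\infty$, $$\frac{1}{N-1}\,\#\left\{2\leq d\leq N:\left|\frac{O_d}{O_{d-1}}-1\right|\geq\varepsilon\right\}\longrightarrow 0.$$
   Context: Binomial expansion: for positive integers $a,t$, there is a unique writing $a=\binom{k(t)}{t}+\binom{k(t-1)}{t-1}+\dots+\binom{k(j)}{j}$ with $k(t)>k(t-1)>\dots>k(j)\geq j\geq 1$; set $a^{\langle t\rangle}:=\binom{k(t)+1}{t+1}+\binom{k(t-1)+1}{t}+\dots+\binom{k(j)+1}{j+1}$, and $0^{\langle t\rangle}:=0$. An $O$-sequence is a sequence $h=(h_0,h_1,h_2,\dots)$ of non-negative integers with $h_0=1$ and $h_{t+1}\leq h_t^{\langle t\rangle}$ for every $t\geq 1$ (equivalently, the Hilbert function of a standard graded algebra over a field). It is finite if it has only finitely many non-zero values; it is then written $h=(h_0,\dots,h_s)$, where $s=\max\{t: h_t\neq 0\}$, and its multiplicity is $d=\sum_{t=0}^s h_t$. For every positive integer $d$, $O_d$ denotes the number of all finite $O$-sequences of multiplicity $d$. *)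

(* Defs.v *)
From HB Require Import structures.
From mathcomp Require Import all_boot all_order all_algebra.
From mathcomp Require Import finmap.
From mathcomp Require Import all_classical all_reals all_analysis.

Set Implicit Arguments.
Unset Strict Implicit.
Unset Printing Implicit Defensive.

Import Order.TTheory GRing.Theory Num.Theory.
Local Open Scope classical_set_scope.

(* a = 'C(k t, t) + 'C(k (t-1), t-1) + ... + 'C(k j, j) with
   k t > k (t-1) > ... > k j >= j >= 1; the values of k outside [j, t] are
   irrelevant. *)
Definition binomial_expansion (a t j : nat) (k : nat -> nat) : Prop :=
  [/\ 1 <= j <= t,
      j <= k j,
      (forall i, j <= i < t -> k i < k i.+1) &
      a = (\sum_(j <= i < t.+1) 'C(k i, i))%N].

(* a^<t>; well defined for 0 < a and 0 < t by binomial_expansion_exists and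
   binomial_expansion_unique, see macaulayE. The default value 0 of xget is
   never reached for 0 < a and 0 < t. *)
Definition macaulay (a t : nat) : nat :=
  if a == 0 then 0 else
  xget 0 [set b | exists j k, binomial_expansion a t j k /\
                    b = (\sum_(j <= i < t.+1) 'C((k i).+1, i.+1))%N].

Definition O_sequence (h : nat -> nat) : Prop :=
  h 0 = 1 /\ forall t, 1 <= t -> h t.+1 <= macaulay (h t) t.

Definition finite_support (h : nat -> nat) : Prop :=
  finite_set [set t | h t != 0].

(* The sum of all the h t, for h of finite support; see multiplicityE. *)
Definition multiplicity (h : nat -> nat) : nat :=
  \big[addn/0]_(t \in [set: nat]) h t.

Definition O_sequences (d : nat) : set (nat -> nat) :=
  [set h | [/\ O_sequence h, finite_support h & multiplicity h = d]].

(* The cardinal of O_sequences d, which is finite by finite_O_sequences. *)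
Definition num_O (d : nat) : nat := #|` fset_set (O_sequences d)|%fset.

Lemma expansion_le_k a t j k i : binomial_expansion a t j k ->
  j <= i <= t -> i <= k i.
Proof.
move=> [_ jk kS _]; elim: i => // i IH /andP[].
rewrite leq_eqVlt => /orP[/eqP <- //|]; rewrite ltnS => ji it.
by apply: leq_ltn_trans (kS i _); [apply: IH; rewrite ji ltnW|rewrite ji it].
Qed.

Lemma expansion_pred a t j k : binomial_expansion a t.+1 j k -> j <= t ->
  binomial_expansion (a - 'C(k t.+1, t.+1)) t j k.
Proof.
move=> [/andP[j1 _] jk kS ->] jt; split=> //; first by rewrite j1.
  by move=> i /andP[ji it]; apply: kS; rewrite ji ltnW.
by rewrite big_nat_recr ?leqW//= addnK.
Qed.

Lemma expansion_bounds a t j k : binomial_expansion a t j k ->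
  'C(k t, t) <= a < 'C((k t).+1, t).
Proof.
elim: t a => [|t IH] a e; first by case: e => /andP[]; case: j.
have [/andP[j1 jt] jk kS aE] := e.
have tk : t.+1 <= k t.+1 by apply: (expansion_le_k e); rewrite jt leqnn.
have lea : 'C(k t.+1, t.+1) <= a by rewrite aE big_nat_recr//= leq_addl.
rewrite lea binS/= -(subnKC lea) ltn_add2l.
move: jt; rewrite leq_eqVlt => /orP[/eqP jt|]; last rewrite ltnS => jt.
  by rewrite aE jt big_nat1 -jt subnn bin_gt0 ltnW// jt.
have /IH/andP[_] := expansion_pred e jt.
move=> /leq_trans; apply; apply: leq_bin2l; apply: kS.
by rewrite jt ltnSn.
Qed.

Lemma expansion_gt0 a t j k : binomial_expansion a t j k -> 0 < a.
Proof.
move=> e; have /andP[+ _] := expansion_bounds e; apply: leq_trans.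
rewrite bin_gt0; apply: (expansion_le_k e).
by case: e => /andP[_ ->]; rewrite leqnn.
Qed.

Lemma binomial_expansion_unique a t j k j' k' :
  binomial_expansion a t j k -> binomial_expansion a t j' k' ->
  j = j' /\ forall i, j <= i <= t -> k i = k' i.
Proof.
elim: t a => [|t IH] a e e'; first by case: e => /andP[]; case: j.
have le m m' b b' : 'C(m, t.+1) <= b < b' -> b' <= 'C(m'.+1, t.+1) -> m <= m'.
  move=> /andP[mb bb'] b'm; rewrite leqNgt; apply/negP => m'm.
  have := leq_bin2l t.+1 m'm.
  by rewrite leqNgt (leq_ltn_trans mb)// (leq_trans bb').
have kk' : k t.+1 = k' t.+1.
  have /andP[a1 a2] := expansion_bounds e.
  have /andP[a1' a2'] := expansion_bounds e'.
  apply/eqP; rewrite eqn_leq (le _ _ a a.+1 _ a2') ?a1 ?ltnSn//.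
  by rewrite (le _ _ a a.+1 _ a2) ?a1' ?ltnSn.
have last_le l q : binomial_expansion a t.+1 l q -> k t.+1 = q t.+1 ->
    l = t.+1 -> a = 'C(k t.+1, t.+1).
  by move=> [_ _ _ ->] -> ->; rewrite big_nat1.
have last_gt l q : binomial_expansion a t.+1 l q -> k t.+1 = q t.+1 ->
    l <= t -> a != 'C(k t.+1, t.+1).
  move=> el kq lt; rewrite kq neq_ltn orbC -subn_gt0.
  by rewrite (expansion_gt0 (expansion_pred el lt)).
have [/andP[_ jt] _ _ _] := e; have [/andP[_ jt'] _ _ _] := e'.
move: jt jt'; rewrite leq_eqVlt [j' <= _]leq_eqVlt !ltnS.
move=> /orP[/eqP jt|jt] /orP[/eqP jt'|jt'].
- split; first by rewrite jt jt'.
  by move=> i; rewrite jt -eqn_leq => /eqP <-.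
- by have := last_gt _ _ e' kk' jt'; rewrite -(last_le _ _ e erefl jt) eqxx.
- by have := last_gt _ _ e erefl jt; rewrite -(last_le _ _ e' kk' jt') eqxx.
have ep' := expansion_pred e' jt'; rewrite -kk' in ep'.
have [<- kE] := IH _ (expansion_pred e jt) ep'; split=> // i /andP[ji].
rewrite leq_eqVlt => /orP[/eqP -> //|]; rewrite ltnS => it.
by apply: kE; rewrite ji it.
Qed.

Lemma binomial_expansion_exists a t : 0 < a -> 0 < t ->
  exists j k, binomial_expansion a t j k.
Proof.
elim: t a => // t IH a a0 _.
have ltC m : m < 'C(m + t.+1, t.+1).
  elim: m => [|m IHm]; first by rewrite add0n binn.
  rewrite addSn binS -addn1 leq_add// bin_gt0.
  by rewrite addnS leqW// leq_addl.
have ex : exists m, 'C(m, t.+1) <= a by exists t.+1; rewrite binn.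
have ub m : 'C(m, t.+1) <= a -> m <= a + t.+1.
  move=> ma; rewrite leqNgt; apply/negP => /ltnW /(leq_bin2l t.+1).
  by rewrite leqNgt (leq_ltn_trans ma).
case: (ex_maxnP ex ub) => m ma mmax.
have tm : t.+1 <= m by apply: mmax; rewrite binn.
have aS : a < 'C(m.+1, t.+1).
  by rewrite ltnNge; apply/negP => /mmax; rewrite ltnn.
have [r0|r0] := posnP (a - 'C(m, t.+1)).
  exists t.+1, (fun=> m); split=> //; first by rewrite ltnSn.
    by move=> i /andP[it]; rewrite ltnNge it.
  by rewrite big_nat1; apply/eqP; rewrite eqn_leq ma -subn_eq0 r0 eqxx.
have rC : a - 'C(m, t.+1) < 'C(m, t).
  by rewrite ltn_subLR// -binS.
have t0 : 0 < t.
  by move: rC; case: t {IH ltC ex ub mmax tm aS ma} r0 => //; rewrite bin0; case: subn.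
have [j [k e]] := IH _ r0 t0.
have [/andP[j1 jt] jk kS rE] := e.
exists j, (fun i => if i == t.+1 then m else k i); split.
- by rewrite j1 leqW.
- by rewrite ltn_eqF// ltnS.
- move=> i /andP[ji]; rewrite ltnS => it.
  rewrite ltn_eqF ?ltnS// eqSS; move: it; rewrite leq_eqVlt => /orP[/eqP ->|it].
    rewrite eqxx ltnNge; apply/negP => /(leq_bin2l t).
    have /andP[kr _] := expansion_bounds e.
    by rewrite leqNgt (leq_ltn_trans kr rC).
  by rewrite ltn_eqF// kS// ji it.
- rewrite big_nat_recr ?leqW//= eqxx -[LHS](subnK ma) rE; congr addn.
  by apply: eq_big_nat => i /andP[_ it]; rewrite ltn_eqF.
Qed.

Lemma macaulayE a t j k : binomial_expansion a t j k ->
  macaulay a t = (\sum_(j <= i < t.+1) 'C((k i).+1, i.+1))%N.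
Proof.
move=> e; rewrite /macaulay gtn_eqF ?(expansion_gt0 e)//.
apply: xget_unique; first by exists j, k.
move=> _ [j' [k' [e' ->]]].
have [<- kk'] := binomial_expansion_unique e e'.
by apply: eq_big_nat => i it; rewrite kk'.
Qed.

Lemma macaulay0 t : macaulay 0 t = 0.
Proof. by rewrite /macaulay eqxx. Qed.

Lemma multiplicityE h s : (forall t, s < t -> h t = 0) ->
  multiplicity h = (\sum_(t < s.+1) h t)%N.
Proof.
move=> hs; rewrite /multiplicity (fsbig_ord _ _ h); apply/esym/fsbig_widen => //.
by move=> t /= [_ /negP]; rewrite -leqNgt => /hs.
Qed.

Lemma O_sequence_support h t u : O_sequence h -> t <= u -> h t = 0 -> h u = 0.
Proof.
move=> [h0 hS] + ht0; elim: u => [|u IH].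
  by rewrite leqn0 => /eqP t0; move: ht0; rewrite t0.
rewrite leq_eqVlt => /orP[/eqP <- //|]; rewrite ltnS => tu.
have u0 : 0 < u by case: u tu {IH} => //; rewrite leqn0 => /eqP t0;
  move: ht0; rewrite t0 h0.
by have := hS u u0; rewrite (IH tu) macaulay0 leqn0 => /eqP.
Qed.

Lemma O_sequences_bound d h : O_sequences d h ->
  (forall t, d <= t -> h t = 0) /\ forall t, h t <= d.
Proof.
move=> [Oh /finite_seqP[r rE] hd].
have hN t : \max_(i <- r) i < t -> h t = 0.
  move=> rt; apply/eqP/negPn/negP => ht.
  have tr : t \in r by have : [set` r] t by rewrite -rE.
  by have := @leq_bigmax_seq _ r xpredT id t tr erefl; rewrite leqNgt rt.
have {}hd := hd; rewrite (multiplicityE hN) in hd.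
set N := \max_(_ <- _) _ in hN hd.
have hle t : h t <= d.
  have [/hN -> //|] := ltnP N t; rewrite -ltnS => tN.
  by rewrite -hd (bigD1 (Ordinal tN))//= leq_addr.
split=> // t dt; apply/eqP/negPn/negP => ht.
have hpos i : i <= t -> 0 < h i.
  move=> it; rewrite lt0n; apply: contra_neq ht; exact: O_sequence_support.
have tN : t <= N by rewrite leqNgt; apply: contra ht => /hN ->.
have : t < \sum_(i < N.+1) h i.
  rewrite -(big_mkord xpredT h) (@big_cat_nat _ _ _ t.+1)//=.
  rewrite (leq_trans _ (leq_addr _ _))// big_mkord.
  rewrite -[X in X <= _](card_ord t.+1) -sum1_card; apply: leq_sum => i _.
  by apply: hpos; rewrite -ltnS.
by rewrite hd ltnNge dt.
Qed.

Lemma finite_O_sequences d : finite_set (O_sequences d).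
Proof.
pose F (f : {ffun 'I_d -> 'I_d.+1}) (t : nat) : nat :=
  if insub t is Some i then f i : nat else 0.
apply: (@sub_finite_set _ _ (range F)); last exact/finite_image/finite_finset.
move=> h /O_sequences_bound[hN hd].
exists [ffun i : 'I_d => inord (h i)] => //; apply/funext => t.
rewrite /F; case: insubP => [i _ <-|]; last by rewrite -leqNgt => /hN.
by rewrite ffunE inordK// ltnS.
Qed.

(* O_d / O_(d-1), meaningful for d >= 2. *)
Definition O_ratio (R : realType) (d : nat) : R :=
  ((num_O d)%:R / (num_O d.-1)%:R)%R.

(* Main.v *)
(** Raising h_1 by one maps O-sequences of multiplicity d injectively to those of
    multiplicity d + 1, and lowering the last non-zero entry by one is at most
    two-to-one, so the ratios O_(d+1) / O_d lie in [1, 2]. If m(m + 1) is about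
    2d, some t <= m has h_t <= t; from there on h_t^<t> = h_t, so h is
    non-increasing and bounded by m. Hence h is determined by its first m + 1
    values and the m parts of the partition conjugate to its tail, and
    log O_d = O(sqrt d log d) = o(d). As x - 1 <= 2 log x on [1, 2], the sum of
    the |O_d / O_(d-1) - 1| telescopes to at most 2 log O_N = o(N), and Markov's
    inequality gives the statistical convergence. *)
Require Import Defs.
From mathcomp Require Import all_boot all_order all_algebra.
From mathcomp Require Import finmap zify lra.
From mathcomp Require Import all_classical all_reals all_analysis.
Import Order.TTheory GRing.Theory Num.Theory.
Import numFieldNormedType.Exports.
Local Open Scope classical_set_scope.

(** * Raising [h 1]: monotonicity of [num_O] *)

Lemma O_sequences_sum d N h : O_sequences d h -> d <= N ->
  \sum_(t < N) h t = d.
Proof.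
move=> Oh dN; have [hd _] := O_sequences_bound Oh.
have [_ _ <-] := Oh; rewrite (@multiplicityE _ N); last first.
  by move=> t /ltnW Nt; apply: hd; apply: leq_trans Nt.
by rewrite big_ord_recr/= hd ?addn0.
Qed.

Lemma O_sequences_intro d N h : O_sequence h -> (forall t, N <= t -> h t = 0) ->
  \sum_(t < N) h t = d -> O_sequences d h.
Proof.
move=> Oh hN hd; split=> //.
  apply: (@sub_finite_set _ _ `I_N); last exact: finite_II.
  by move=> t /= ht; rewrite ltnNge; apply: contra ht => /hN ->.
rewrite (@multiplicityE _ N) => [|t /ltnW]; last exact: hN.
by rewrite big_ord_recr/= hN// addn0.
Qed.

Lemma O_sequences_gt0 d h : O_sequences d h -> 0 < d.
Proof.
move=> Oh; have [[h0 _] _ _] := Oh.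
by rewrite -(O_sequences_sum _ d.+1 _ Oh (leqnSn d)) big_ord_recl h0.
Qed.

Definition incr_at (s : nat) (h : nat -> nat) (t : nat) : nat := h t + (t == s).

Lemma incr_at_inj s : injective (incr_at s).
Proof.
move=> h h' hh'; apply/funext => t.
by have /(congr1 (fun f => f t))/eqP := hh'; rewrite /incr_at eqn_add2r => /eqP.
Qed.

Lemma sum_incr_at s N h : s < N ->
  \sum_(t < N) incr_at s h t = (\sum_(t < N) h t).+1.
Proof.
move=> sN; rewrite big_split/= -addn1; congr addn.
rewrite (bigD1 (Ordinal sN))//= eqxx big1// => i /negbTE.
by rewrite -val_eqE/= => ->.
Qed.

Lemma macaulay1 a : macaulay a 1 = 'C(a.+1, 2).
Proof.
case: a => [|a]; first by rewrite macaulay0.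
rewrite (@macaulayE a.+1 1 1 (fun=> a.+1)) ?big_nat1//.
by split=> //; [move=> i; lia|rewrite big_nat1 bin1].
Qed.

(** For 0 < a the expansion consists of the a terms 'C(i, i) = 1 with t - a < i <= t, and each
    raised term 'C(i+1, i+1) is again 1. *)
Lemma macaulay_small a t : 0 < t -> a <= t -> macaulay a t = a.
Proof.
case: a => [|a] t0 at'; first by rewrite macaulay0.
have sumE (F : nat -> nat) : (forall i, F i = 1) ->
    \sum_(t - a <= i < t.+1) F i = a.+1.
  move=> F1; under eq_bigr do rewrite F1.
  by rewrite sum_nat_const_nat muln1; lia.
rewrite (@macaulayE a.+1 t (t - a) id) ?sumE// => [i|]; first by rewrite binn.
by split=> //; [lia|rewrite sumE// => i; rewrite binn].
Qed.

(** No growth condition bounds [h 1], and the bound 'C(h 1 + 1, 2) on [h 2] only gets weaker. *)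
Lemma O_sequences_incr1 d h : O_sequences d h -> O_sequences d.+1 (incr_at 1 h).
Proof.
move=> Oh; have [[h0 hS] _ _] := Oh; have [hd _] := O_sequences_bound Oh.
have d0 := O_sequences_gt0 _ _ Oh.
apply: (@O_sequences_intro _ d.+1).
- split=> [|t t1]; first by rewrite /incr_at h0.
  have := hS t t1; rewrite /incr_at; case: t t1 => [//|[_|t _]].
    by rewrite !macaulay1 addn0 => /leq_trans; apply; apply: leq_bin2l; lia.
  by rewrite !addn0.
- by move=> t dt; rewrite /incr_at hd; lia.
- by rewrite sum_incr_at// (O_sequences_sum d).
Qed.

Lemma leq_num_O d : num_O d <= num_O d.+1.
Proof.
have -> : num_O d = #|` incr_at 1 @` fset_set (O_sequences d)|%fset.
  by rewrite card_imfset//; apply: incr_at_inj.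
rewrite -fset_set_image; last exact: finite_O_sequences.
apply: fsubset_leq_card; rewrite -fset_set_sub; last 2 first.
- exact/finite_image/finite_O_sequences.
- exact: finite_O_sequences.
by move=> _ [h Oh <-]; apply: O_sequences_incr1.
Qed.

Lemma num_O1_gt0 : 0 < num_O 1.
Proof.
rewrite cardfs_gt0; apply/fset0Pn; exists (fun t => (t == 0 : nat)).
rewrite in_fset_set; last exact: finite_O_sequences.
apply/mem_set/(@O_sequences_intro _ 1) => [|t|]; first by [].
  by case: t.
by rewrite big_ord1.
Qed.

Lemma num_O_gt0 d : 0 < d -> 0 < num_O d.
Proof.
case: d => // d _; elim: d => [|d IH]; first exact: num_O1_gt0.
exact: leq_trans IH (leq_num_O _).
Qed.

(** * Lowering the last non-zero entry: [num_O] at most doubles *)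

Definition has_length (h : nat -> nat) (n : nat) : Prop :=
  forall t, (h t != 0) = (t < n).

(** Being computed from the lowered sequence alone, the length gives just two candidate positions at
    which to undo the lowering. The default 0 is not reached on [O_sequences d], by
    [O_sequences_length]. *)
Definition length_of (h : nat -> nat) : nat := xget 0 [set n | has_length h n].

Lemma length_ofE h n : has_length h n -> length_of h = n.
Proof.
move=> hn; apply: xget_unique => // n' hn'; have := hn n; have := hn n'.
by rewrite !hn'; lia.
Qed.

Lemma O_sequences_length d h : O_sequences d h -> exists n, has_length h n.
Proof.
move=> Oh; have [Ohs _ _] := Oh; have [hd _] := O_sequences_bound Oh.
have ex : exists n, h n == 0 by exists d; rewrite hd.
case: (ex_minnP ex) => n /eqP hn nmin; exists n => t.
have [nt|tn] := leqP n t.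
  by rewrite (O_sequence_support Ohs nt hn).
by apply/negP => /nmin; rewrite leqNgt tn.
Qed.

(* h' is h with its last non-zero entry lowered by one; the two cases record
   whether that entry was 1. *)
Lemma O_sequences_decr_last d h : O_sequences d.+2 h ->
  exists2 h', O_sequences d.+1 h' &
    h = incr_at (length_of h') h' \/ h = incr_at (length_of h').-1 h'.
Proof.
move=> Oh; have [n hn] := O_sequences_length _ _ Oh.
have [[h0 hS] _ _] := Oh; have [hd _] := O_sequences_bound Oh.
(* Multiplicity at least 2 ensures that the entry to be lowered is not [h 0]. *)
have n1 : 1 < n.
  rewrite ltnNge; apply/negP => n1.
  have := O_sequences_sum _ _ _ Oh (leqnn _).
  rewrite big_ord_recl big1 ?h0// => i _.
  by apply/eqP/negPn; rewrite hn lift0; lia.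
case: n n1 hn => // n n1 hn.
have hn0 : 0 < h n by rewrite lt0n hn.
pose h' t := h t - (t == n).
have hE : h = incr_at n h'.
  apply/funext => t; rewrite /incr_at /h' subnK//.
  by case: eqP => [->|].
have nd : n < d.+2.
  by rewrite ltnNge; apply/negP => /hd hn0'; rewrite hn0' in hn0.
exists h'.
  apply: (@O_sequences_intro _ d.+2).
  - split=> [|t t1]; first by rewrite /h' h0; case: n n1 {hn hn0 h' hE nd}.
    (* The right side of the growth bound drops only at [t = n], where the next entry is 0. *)
    rewrite /h'; have [->|_] := eqVneq t n.
      by have /esym := hn n.+1; rewrite ltnn => /esym/negbFE/eqP ->.
    by rewrite subn0 (leq_trans (leq_subr _ _))// hS.
  - by move=> t dt; rewrite /h' hd.
  - by apply/succn_inj; rewrite -(sum_incr_at n)// -hE (O_sequences_sum d.+2).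
have [hn1|hn1] := eqVneq (h n) 1.
  left; rewrite (@length_ofE _ n)// => t; rewrite /h'.
  have := hn t; have [->|tn] := eqVneq t n; first by rewrite hn1 ltnn.
  by rewrite subn0 ltnS leq_eqVlt (negbTE tn).
right; rewrite (@length_ofE _ n.+1)// => t; rewrite /h'.
have := hn t; have [->|tn] := eqVneq t n; last by rewrite subn0.
by rewrite ltnSn => _; apply/eqP; lia.
Qed.

Lemma num_O_leq_double d : num_O d.+2 <= 2 * num_O d.+1.
Proof.
pose O := O_sequences d.+1.
pose f h := incr_at (length_of h) h; pose g h := incr_at (length_of h).-1 h.
have fO : finite_set O by apply: finite_O_sequences.
have sub : (fset_set (O_sequences d.+2) `<=`
            (f @` fset_set O) `|` (g @` fset_set O))%fset.
  rewrite -!fset_set_image// -fset_setU; try exact: finite_image.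
  rewrite -fset_set_sub; last 2 first.
  - exact: finite_O_sequences.
  - by rewrite finite_setU; split; apply: finite_image.
  move=> h /O_sequences_decr_last[h' Oh' [->|->]]; [left|right]; by exists h'.
apply: leq_trans (fsubset_leq_card sub) _.
rewrite (leq_trans (leq_card_fsetU _ _).1)//.
by rewrite mul2n -addnn leq_add// leq_imfset_card.
Qed.

(** * Subexponential growth of [num_O] *)

(** Otherwise h_t >= t + 1 for all t <= m, and the multiplicity is at least (m + 1)(m + 2) / 2 >
    d. *)
Lemma O_sequences_small d h m : O_sequences d h -> 2 * d < m.+1 * m.+2 ->
  exists2 t, 0 < t <= m & h t <= t.
Proof.
move=> Oh dm; apply/not_exists2P => nex.
have hgt t : t <= m -> t < h t.
  have [[h0 _] _ _] := Oh; case: t => [|t] tm; first by rewrite h0.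
  by rewrite ltnNge; apply/negP => hle; case: (nex t.+1) => //; apply.
have le_sum : \sum_(t < m.+1) t.+1 <= d.
  (* The range is widened to d + m + 1 because m + 1 may exceed d. *)
  rewrite -(O_sequences_sum _ (d + m.+1) _ Oh) ?leq_addr//.
  rewrite -[X in _ <= X](big_mkord xpredT h) (@big_cat_nat _ _ _ m.+1)//= ?leq_addl//.
  rewrite (leq_trans _ (leq_addr _ _))// big_mkord; apply: leq_sum => i _.
  by apply: hgt; rewrite -ltnS.
have : 2 * \sum_(t < m.+1) t.+1 = m.+1 * m.+2.
  elim: (m) => [|n IH]; first by rewrite big_ord1.
  by rewrite big_ord_recr/= mulnDr IH; lia.
lia.
Qed.

(** Once h_u <= t <= u, [macaulay_small] gives h_(u+1) <= h_u <= t, so the situation persists for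
    all later u. *)
Lemma O_sequences_tail d h m : O_sequences d h -> 2 * d < m.+1 * m.+2 ->
  h m <= m /\ forall i j, i <= j -> h (m + j) <= h (m + i).
Proof.
move=> Oh dm; have [[_ hS] _ _] := Oh.
have [t /andP[t0 tm] ht] := O_sequences_small _ _ _ Oh dm.
have step u : t <= u -> h u <= t /\ h u.+1 <= h u.
  elim: u => [|u IH]; first by rewrite leqn0 => /eqP tE; rewrite tE in t0.
  have bound v : t <= v -> h v <= t -> h v.+1 <= h v.
    move=> tv hv; have v0 := leq_trans t0 tv.
    by apply: leq_trans (hS v v0) _; rewrite macaulay_small// (leq_trans hv).
  rewrite leq_eqVlt => /orP[/eqP <-|]; first by split=> //; apply: bound.
  rewrite ltnS => tu; have [hu hu'] := IH tu.
  have huS := leq_trans hu' hu.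
  by split=> //; apply: bound; rewrite // leqW.
split; first by have [hm _] := step m tm; apply: leq_trans hm tm.
move=> i j /subnK <-; elim: (j - i) => // n IHn.
rewrite addSn addnS; apply: leq_trans IHn.
by have [] := step (m + (n + i)); rewrite // (leq_trans tm) ?leq_addr.
Qed.

(** The sum is the length of the initial segment cut out by [p]. This lets a partition be read back
    from its conjugate. *)
Lemma count_antitone (p : nat -> bool) d i :
  (forall a b, a <= b -> p b -> p a) -> (forall a, d <= a -> ~~ p a) ->
  (i < \sum_(a < d) p a) = p i.
Proof.
move=> anti pd; have [pi|npi] := boolP (p i).
  have id' : i < d by rewrite ltnNge; apply/negP => /pd; rewrite pi.
  rewrite -(big_mkord xpredT (fun a => p a : nat)) (@big_cat_nat _ _ _ i.+1)//=.
  rewrite (leq_trans _ (leq_addr _ _))// big_mkord.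
  rewrite -[X in X <= _](card_ord i.+1) -sum1_card leq_sum// => a _.
  by rewrite lt0b; apply: anti pi; rewrite -ltnS.
apply/negbTE; rewrite -leqNgt.
apply: (@leq_trans (\sum_(a < d) (a < i))).
  apply: leq_sum => a _; case: ltnP => [_|ia]; first exact: leq_b1.
  by rewrite leqn0 eqb0; apply: contra npi; apply: anti.
apply: leq_trans (geq_minr d i); elim: d {pd} => [|d IH]; first by rewrite big_ord0.
rewrite big_ord_recr/=; case: (ltnP d i) => di; move: IH;
  by rewrite !leq_min; move: (\sum_(a < d) _) => S; rewrite /= ?addn0 ?addn1; lia.
Qed.

Lemma leq_num_O_exp d m : 2 * d < m.+1 * m.+2 -> num_O d <= d.+1 ^ (2 * m).+1.
Proof.
move=> dm.
(* The parts of the partition conjugate to the tail from m on; those with v >= m vanish since the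
   tail is bounded by m. *)
pose conj (h : nat -> nat) v := \sum_(i < d) (v < h (m + i)).
pose code (h : nat -> nat) := ([ffun t : 'I_m.+1 => inord (h t) : 'I_d.+1],
                [ffun v : 'I_m => inord (conj h v) : 'I_d.+1]).
have conj_le h v : conj h v <= d.
  rewrite -[X in _ <= X](card_ord d) -sum1_card.
  by apply: leq_sum => i _; apply: leq_b1.
have code_inj : {in fset_set (O_sequences d) &, injective code}.
  move=> h h'; rewrite !in_fset_set; try exact: finite_O_sequences.
  move=> /set_mem Oh /set_mem Oh' [] /ffunP eh /ffunP ec; apply/funext => t.
  have [hd hle] := O_sequences_bound Oh.
  have [hd' hle'] := O_sequences_bound Oh'.
  have [tm|mt] := leqP t m.
    have := eh (Ordinal (tm : t < m.+1)); rewrite !ffunE => /(congr1 (@nat_of_ord _)).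
    by rewrite !inordK ?ltnS.
  have [hm hanti] := O_sequences_tail _ _ _ Oh dm.
  have [hm' hanti'] := O_sequences_tail _ _ _ Oh' dm.
  rewrite -(subnKC (ltnW mt)); set i := t - m.
  have conjE g v : O_sequences d g ->
      (forall i j, i <= j -> g (m + j) <= g (m + i)) ->
      (i < conj g v) = (v < g (m + i)).
    move=> Og ganti.
    apply: (@count_antitone (fun i => v < g (m + i))) => [a b ab|].
      by move=> /leq_trans; apply; apply: ganti.
    move=> a da; have [g0 _] := O_sequences_bound Og.
    by rewrite g0 ?(leq_trans da) ?leq_addl.
  have same v : v < m -> (v < h (m + i)) = (v < h' (m + i)).
    move=> vm; rewrite -!conjE//; congr (_ < _).
    have := ec (Ordinal vm); rewrite !ffunE => /(congr1 (@nat_of_ord _)).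
    by rewrite !inordK ?ltnS.
  have := hanti 0 i (leq0n _); have := hanti' 0 i (leq0n _).
  rewrite !addn0 => h1 h2.
  (* If the two values differed, the smaller one would be a v < m that separates them. *)
  have := same (h (m + i)); have := same (h' (m + i)); rewrite !ltnn; lia.
have -> : num_O d = #|` code @` fset_set (O_sequences d)|%fset.
  by rewrite card_in_imfset.
have -> : d.+1 ^ (2 * m).+1 = #|{: {ffun 'I_m.+1 -> 'I_d.+1} * {ffun 'I_m -> 'I_d.+1}}|.
  by rewrite card_prod !card_ffun !card_ord -expnD; congr (_ ^ _); lia.
rewrite -(card_uniqP (fset_uniq _)); exact: max_card.
Qed.

(* With r the integer fourth root of N and m = 2 (r + 1)^2, the previous bound
   gives O_N <= 2 ^ (80 r^3). *)
Lemma num_O_subexp k : exists N0, forall N, N0 <= N -> num_O N ^ k <= 2 ^ N.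
Proof.
(* This threshold forces r > 80 k, so that 80 k r^3 <= r^4 <= N. *)
exists ((80 * k).+1 ^ 4) => N kN.
have ex : exists r, r ^ 4 <= N by exists (80 * k).+1.
have ub r : r ^ 4 <= N -> r <= N.
  by apply: leq_trans; case: r => // r; rewrite expnS leq_pmulr ?expn_gt0.
case: (ex_maxnP ex ub) => r rN rmax; have kr := rmax _ kN.
have Nr : N < r.+1 ^ 4 by rewrite ltnNge; apply/negP => /rmax; rewrite ltnn.
pose m := 2 * r.+1 ^ 2.
have mE : m * m = 4 * r.+1 ^ 4 by rewrite /m; lia.
have Nm : 2 * N < m.+1 * m.+2 by nia.
have rexp : r.+1 ^ 4 <= 2 ^ (4 * r).
  by rewrite mulnC expnM leq_exp2r// ltn_expl.
apply: (@leq_trans ((2 ^ (4 * r * (2 * m).+1)) ^ k)).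
  case: k {kN ex kr} => // k; rewrite leq_exp2r//.
  apply: leq_trans (leq_num_O_exp _ _ Nm) _.
  by rewrite [2 ^ _]expnM leq_exp2r// (leq_trans Nr).
rewrite -expnM leq_pexp2l//; apply: leq_trans rN.
have r0 : 0 < r by lia.
(* As r >= 1, 2m + 1 = 4(r + 1)^2 + 1 <= 17 r^2; the exponent 4r(2m + 1) is then at most 80 r^3. *)
have m5 : (2 * m).+1 <= 20 * r ^ 2.
  by rewrite /m; nia.
apply: (@leq_trans (80 * k * r ^ 3)); last by rewrite [r ^ 4]expnS leq_mul2r; lia.
rewrite [r ^ 3]expnS.
by nia.
Qed.

(** * Logarithmic estimates and convergence of the ratios *)

Local Open Scope ring_scope.

(** From ln (1/x) <= 1/x - 1 follows ln x >= (x - 1) / x >= (x - 1) / 2. *)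
Lemma ler_subr1_ln (R : realType) (x : R) : 1 <= x <= 2 -> x - 1 <= 2 * ln x.
Proof.
move=> /andP[x1 x2]; have x0 : 0 < x by lra.
have xV : x * x^-1 = 1 by rewrite divff// gt_eqF.
have xV1 : 2^-1 <= x^-1 by rewrite lef_pV2 ?posrE.
have := @le_ln1Dx R (x^-1 - 1).
rewrite addrCA subrr addr0 lnV ?posrE// => lnle.
have {lnle} : - ln x <= x^-1 - 1 by apply: lnle; lra.
by nra.
Qed.

Lemma O_ratio_bounds (R : realType) d : (0 < d)%N -> 1 <= O_ratio R d.+1 <= 2.
Proof.
move=> d0; have Od : 0 < (num_O d)%:R :> R by rewrite ltr0n num_O_gt0.
rewrite /O_ratio /= ler_pdivlMr// ler_pdivrMr// mul1r -natrM !ler_nat leq_num_O.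
by case: d d0 {Od} => // d _; rewrite num_O_leq_double.
Qed.

Lemma sum_O_ratio_le (R : realType) N : (0 < N)%N ->
  \sum_(2 <= d < N.+1) `|O_ratio R d - 1| <= 2 * ln (num_O N)%:R.
Proof.
case: N => // N _; elim: N => [|N IH].
  by rewrite big_geq// mulr_ge0// ln_ge0// ler1n num_O_gt0.
have := @O_ratio_bounds R N.+1 isT => r12; have /andP[r1 _] := r12.
rewrite big_nat_recr//= ger0_norm ?subr_ge0//.
apply: le_trans (lerD IH (ler_subr1_ln _ _ r12)) _.
rewrite /O_ratio /= ln_div ?posrE ?ltr0n ?num_O_gt0//; lra.
Qed.

Lemma O_ratio_Cesaro_near (R : realType) (eps : R) : 0 < eps ->
  \forall N \near \oo, 0 < N%:R - 1 :> R /\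
    \sum_(2 <= d < N.+1) `|O_ratio R d - 1| <= eps * (N%:R - 1).
Proof.
(* The sum is at most 2 ln O_N <= 2N / k. One factor 2 of the 4 comes from here, the other from N <=
   2 (N - 1) for N >= 2. *)
move=> eps0; pose k := Num.bound (4 / eps).
have : 4 / eps < k%:R by apply: archi_boundP; rewrite divr_ge0// ltW.
rewrite ltr_pdivrMr// => keps.
have [N0 ON0] := num_O_subexp k.
exists (maxn N0 2) => // N /=; rewrite geq_max => /andP[/ON0 ON N2].
have NR : 2 <= N%:R :> R by rewrite ler_nat.
have ln2 : ln 2 <= 1 :> R by rewrite -[2]/(1 + 1) le_ln1Dx//; lra.
have O0 : 0 < (num_O N)%:R :> R by rewrite ltr0n num_O_gt0// ltnW.
have kln : k%:R * ln (num_O N)%:R <= N%:R :> R.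
  rewrite mulr_natl -lnXn// -natrX.
  apply: (@le_trans _ _ (ln (2 ^ N)%:R)).
    by rewrite ler_ln ?posrE ?ltr0n ?expn_gt0 ?num_O_gt0 ?(ltnW N2)// ler_nat.
  by rewrite natrX lnXn// -[ln 2 *+ N]mulr_natl ler_piMr.
split; first lra.
have S2 := sum_O_ratio_le R N (ltnW N2).
have k0 : 0 < k%:R :> R.
  by rewrite -(pmulr_rgt0 _ eps0) mulrC; lra.
rewrite -(ler_pM2l k0); nra.
Qed.

Theorem proposition3p4 (R : realType) :
  ((N%:R - 1)^-1 * \sum_(2 <= d < N.+1) `|O_ratio R d - 1|
     @[N --> \oo] --> (0 : R)) /\
  (forall eps : R, 0 < eps ->
     (N%:R - 1)^-1 *
       (count (fun d => eps <= `|O_ratio R d - 1|) (index_iota 2 N.+1))%:R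
     @[N --> \oo] --> (0 : R)).
Proof.
split=> [|eps eps0]; apply/cvgrPdist_le => e e0.
  near=> N; have [N1 SN] : 0 < N%:R - 1 :> R /\
    \sum_(2 <= d < N.+1) `|O_ratio R d - 1| <= e * (N%:R - 1).
    by near: N; apply: O_ratio_Cesaro_near.
  rewrite sub0r normrN ger0_norm; last by rewrite mulr_ge0 ?sumr_ge0 ?invr_ge0 ?(ltW N1).
  by rewrite ler_pdivrMl// mulrC.
(* Markov's inequality: each counted d contributes at least [eps] to the sum, hence the tolerance
   [eps * e]. *)
near=> N; have [N1 SN] : 0 < N%:R - 1 :> R /\
  \sum_(2 <= d < N.+1) `|O_ratio R d - 1| <= (eps * e) * (N%:R - 1).
  by near: N; apply: O_ratio_Cesaro_near; apply: mulr_gt0.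
rewrite sub0r normrN ger0_norm; last by rewrite mulr_ge0 ?invr_ge0 ?(ltW N1).
rewrite ler_pdivrMl// mulrC -(ler_pM2l eps0) mulrA; apply: le_trans SN.
rewrite -sum1_count natr_sum mulr_sumr big_mkcond/=; apply: ler_sum => d _.
by case: ifP => // ?; rewrite mulr1.
Unshelve. all: by end_near.
Qed.
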